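(* Let $(P,\preccurlyeq)$ be a finite poset with $|P|>1$ whose Hasse diagram $H(P)$ is connected. Then the piping complex of $P$ is isomorphic to the acyclic nested complex of the poset oriented building set $(\mathcal{B}(P),\mathcal{M}(P))$ of $P$.
   Context: A pipe of $P$ is a subset $Q\subseteq P$ with $|Q|>1$ which induces a connected subgraph of $H(P)$ and is order convex ($p\preccurlyeq q\preccurlyeq r$ and $p,r\in Q$ imply $q\in Q$). Let $\mathcal{D}(P)$ be the directed graph with a vertex for each pipe and an arc from $Q$ to $R$ if $Q\cap R=\varnothing$ and there are $q\in Q$, $r\in R$ with $q\prec r$. A piping of $P$ is a set of pairwise nested or disjoint pipes of $P$ which contains the pipe $P$ and induces an acyclic subgraph (no directed cycle) of $\mathcal{D}(P)$. The piping complex of $P$ is the simplicial complex whose faces are $\mathcal{Q}\setminus\{P\}$ for all pipings $\mathcal{Q}$ of $P$. Let $S$ be the set of arcs of $H(P)$, i.e. cover relations $p\prec q$, regarded as arcs directed from $p$ to $q$. $\mathcal{M}(P)$ is the graphical oriented matroid of the directed graph $H(P)$: the oriented matroid on $S$ of the vector configuration $(b_u-b_v)_{(u,v)\in S}$ in $\mathbb{R}^P$ with standard basis $(b_v)_{v\in P}$; its circuits are the simple cycles of $H(P)$ with signs given by clockwise and counter-clockwise arcs. It is acyclic. A face of $\mathcal{M}(P)$ is a set $F\subseteq S$ such that $(S\setminus F,\varnothing)$ is a covector, i.e. some linear form vanishes on the vectors indexed by $F$ and is positive on those indexed by $S\setminus F$. The line graph $L(P)$ is the graph on $S$ joining two arcs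 sharing an endpoint, and $\mathcal{B}(P)$ is the set of all non-empty subsets of $S$ inducing a connected subgraph of $L(P)$. For a building set $\mathcal{B}$ on $S$, $\kappa(\mathcal{B})$ denotes the set of its inclusion-maximal elements. A nested set on $\mathcal{B}$ is a subset $\mathcal{N}\subseteq\mathcal{B}$ containing $\kappa(\mathcal{B})$ such that any two elements are nested or disjoint, and the union of any $k\ge2$ pairwise disjoint elements of $\mathcal{N}$ is not in $\mathcal{B}$. It is acyclic for $\mathcal{M}$ if $\bigcup\mathcal{N}'$ is a face of $\mathcal{M}$ for every $\mathcal{N}'\subseteq\mathcal{N}$. The acyclic nested complex of $(\mathcal{B},\mathcal{M})$ is the simplicial complex whose faces are the sets $\mathcal{N}\setminus\kappa(\mathcal{B})$ for all acyclic nested sets $\mathcal{N}$. *)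

(* Defs.v *)
From HB Require Import structures.
From mathcomp Require Import all_boot all_order all_algebra.
From mathcomp Require Import boolp reals.

Set Implicit Arguments.
Unset Strict Implicit.
Unset Printing Implicit Defensive.

Import Order.TTheory GRing.Theory Num.Theory.

Local Open Scope ring_scope.

Section SimplicialComplexes.

Record simplicial_complex (V : finType) := SimplicialComplex {
  faces : {set {set V}};
  faces_closed : forall F G : {set V}, F \in faces -> G \subset F -> G \in faces
}.

(* The elements of V that are not vertices play no role. *)
Definition vertices (V : finType) (K : simplicial_complex V) : {set V} :=
  [set v | [set v] \in faces K].

Definition simplicial_iso (V W : finType)
    (K : simplicial_complex V) (L : simplicial_complex W) : Prop :=
  exists f : {v | v \in vertices K} -> {w | w \in vertices L},
    bijective f /\
    forall F : {set {v | v \in vertices K}},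
      (val @: F \in faces K) = (val @: (f @: F) \in faces L).

End SimplicialComplexes.

Section Graphs.
Variable T : finType.

(* The empty set counts as connected; every use below also requires
   nonemptiness. *)
Definition induces_connected (e : rel T) (A : {set T}) : bool :=
  [forall x in A, forall y in A,
     connect [rel u v | [&& u \in A, v \in A & e u v]] x y].

Definition induces_acyclic (e : rel T) (A : {set T}) : Prop :=
  forall c : seq T, c != [::] -> {subset c <= A} -> ~ ucycle e c.

Definition nested_or_disjoint (A B : {set T}) : bool :=
  [|| A \subset B, B \subset A | [disjoint A & B]].

End Graphs.

Section PipingComplex.
Variables (d : Order.disp_t) (P : finPOrderType d).

Definition covers (p q : P) : bool :=
  (p < q)%O && [forall r : P, ~~ (p < r < q)%O].

Definition hasse : rel P := [rel p q | covers p q || covers q p].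

Definition order_convex (Q : {set P}) : bool :=
  [forall p in Q, forall q : P, forall r in Q, (p <= q <= r)%O ==> (q \in Q)].

Definition pipe (Q : {set P}) : bool :=
  [&& (1 < #|Q|)%N, induces_connected hasse Q & order_convex Q].

Definition pipe_arc : rel {set P} :=
  [rel Q R : {set P} |
     [disjoint Q & R] && [exists q in Q, exists r in R, (q < r)%O]].

Definition is_piping (N : {set {set P}}) : Prop :=
  [/\ {in N, forall Q, pipe Q},
      {in N &, forall Q R, nested_or_disjoint Q R},
      [set: P] \in N
    & induces_acyclic pipe_arc N].

Definition piping_faces : {set {set {set P}}} :=
  [set N :\ [set: P] | N in [set N | `[< is_piping N >]]].

Lemma piping_faces_closed (F G : {set {set P}}) :
  F \in piping_faces -> G \subset F -> G \in piping_faces.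
Proof.
case/imsetP=> N; rewrite inE => /asboolP [Np Nn NT Na] ->{F} sGN.
have TG : [set: P] \notin G.
  by apply/negP => /(subsetP sGN); rewrite !inE eqxx.
apply/imsetP; exists ([set: P] |: G); last by rewrite setU1K.
have sN : {subset [set: P] |: G <= N}.
  move=> Q; rewrite inE in_set1 => /orP[/eqP-> //|/(subsetP sGN)].
  by rewrite inE => /andP[].
rewrite inE; apply/asboolP; split.
- by move=> Q /sN; apply: Np.
- by move=> Q R /sN QN /sN; apply: Nn.
- by rewrite setU11.
- by move=> c c0 cs; apply: Na => // Q /cs /sN.
Qed.

Definition piping_complex : simplicial_complex {set P} :=
  SimplicialComplex piping_faces_closed.

End PipingComplex.

(* An oriented matroid on S is represented by its set of covectors; a signed
   subset of S is the pair of its positive and negative parts. *)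
Section OrientedMatroids.
Variable S : finType.

Definition signed_set := ({set S} * {set S})%type.

Definition is_face (M : {set signed_set}) (F : {set S}) : bool :=
  (~: F, set0) \in M.

Definition vector_matroid (R : realType) (V : lmodType R) (a : S -> V) :
    {set signed_set} :=
  [set X : signed_set | `[< exists f : {scalar V},
     X = ([set s | 0 < f (a s)], [set s | f (a s) < 0]) >]].

End OrientedMatroids.

Section NestedComplex.
Variables (S : finType) (B : {set {set S}}) (M : {set signed_set S}).

Definition maximal_blocks : {set {set S}} :=
  [set A | maxset (fun A' => A' \in B) A].

(* In MathComp [trivIset N'] says that distinct members of N' are disjoint,
   and [cover N'] is the union of the members of N'. *)
Definition nested_set (N : {set {set S}}) : Prop :=
  [/\ N \subset B,
      maximal_blocks \subset N,
      {in N &, forall A A', nested_or_disjoint A A'}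
    & forall N' : {set {set S}},
        N' \subset N -> (2 <= #|N'|)%N -> trivIset N' -> cover N' \notin B].

Definition acyclic_nested_set (N : {set {set S}}) : Prop :=
  nested_set N /\
  forall N' : {set {set S}}, N' \subset N -> is_face M (cover N').

Definition acyclic_nested_faces : {set {set {set S}}} :=
  [set N :\: maximal_blocks | N in [set N | `[< acyclic_nested_set N >]]].

Lemma acyclic_nested_faces_closed (F G : {set {set S}}) :
  F \in acyclic_nested_faces -> G \subset F -> G \in acyclic_nested_faces.
Proof.
case/imsetP=> N; rewrite inE => /asboolP [[NB Nk Nn Nu] Na] ->{F} sGN.
have Gk : [disjoint G & maximal_blocks].
  by move: sGN; rewrite subsetD => /andP[].
apply/imsetP; exists (maximal_blocks :|: G); last first.
  rewrite setDUl setDv set0U; apply/esym/setDidPl; exact: Gk.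
have sN : maximal_blocks :|: G \subset N.
  by rewrite subUset Nk (subset_trans sGN) ?subsetDl.
rewrite inE; apply/asboolP; split; first split.
- exact: subset_trans NB.
- exact: subsetUl.
- by move=> A A' /(subsetP sN) AN /(subsetP sN); apply: Nn.
- by move=> N' sN'; apply: Nu; apply: subset_trans sN.
- by move=> N' sN'; apply: Na; apply: subset_trans sN.
Qed.

Definition acyclic_nested_complex : simplicial_complex {set S} :=
  SimplicialComplex acyclic_nested_faces_closed.

End NestedComplex.

Section PosetOrientedBuildingSet.
Variables (d : Order.disp_t) (P : finPOrderType d).

Definition hasse_arc := {a : P * P | covers a.1 a.2}.

Definition line_graph : rel hasse_arc :=
  [rel a b : hasse_arc | (a != b) &&
     [|| (val a).1 == (val b).1, (val a).1 == (val b).2,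
         (val a).2 == (val b).1 | (val a).2 == (val b).2]].

Definition poset_building_set : {set {set hasse_arc}} :=
  [set A | (A != set0) && induces_connected line_graph A].

Variable R : realType.

Definition std_basis (v : P) : {ffun P -> R^o} := [ffun w => (w == v)%:R].

Definition arc_vector (a : hasse_arc) : {ffun P -> R^o} :=
  std_basis (val a).1 - std_basis (val a).2.

Definition poset_matroid : {set signed_set hasse_arc} :=
  vector_matroid arc_vector.

End PosetOrientedBuildingSet.

(* Main.v *)
From HB Require Import structures.
Require Import Defs.
From mathcomp Require Import all_boot all_order all_algebra.
From mathcomp Require Import reals.
From mathcomp Require Import boolp.


(** The isomorphism sends a pipe [Q] to the set [arcs_in Q] of cover relations
    with both ends in [Q]; its inverse sends a block [A] to the set [ends_of A]
    of all endpoints of its arcs.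

    Evaluating linear forms on the standard basis turns a face [A] of the
    graphical matroid into a function [f] on the poset which is constant along
    the arcs of [A] and strictly decreasing along all other arcs ([is_faceP]).
    Such an [f] is antitone, and if it takes the same value at both ends of a
    saturated chain then every arc of the chain lies in [A]. Hence a connected
    face is the arc set of an order convex connected set, that is, of a pipe
    ([face_block]).

    For families, two comparisons are needed.

    - Disjointness. Disjoint pipes have no arc of one adjacent to an arc of the
      other, so the union of their arc sets is disconnected. Conversely two
      disjoint connected sets of arcs with a common endpoint have a connected
      union, which the definition of a nested set forbids.

    - Acyclicity. If pairwise disjoint pipes induce no directed cycle, then
      following the order and moving freely inside each pipe gives a preorder
      whose only identifications are those forced by the pipes; the number of
      elements above [x] in this preorder is the required function
      ([disjoint_pipes_face]). An arbitrary subfamily of a piping reduces to its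
      maximal members. Conversely, a function [f] as above for the union of the
      arc sets of the pipes of a directed cycle is constant on each of these
      pipes. At a largest pipe [Q] of the cycle among those through a point
      where [f] is smallest, the next arc of the cycle cannot make [f] decrease,
      so it follows a chain of arcs from inside [Q] to outside [Q] on which [f]
      is constant; the arc leaving [Q] belongs to another pipe of the cycle,
      which would have to contain [Q] strictly ([faces_acyclic]). *)

Set Implicit Arguments.
Unset Strict Implicit.
Unset Printing Implicit Defensive.

Import Order.TTheory GRing.Theory Num.Theory.

Local Open Scope ring_scope.

Local Notation within e A := [rel u v | [&& u \in A, v \in A & e u v]].

(** * Isomorphisms of simplicial complexes *)

Section Complexes.
Variables (V W : finType).
Variables (K : simplicial_complex V) (L : simplicial_complex W).

(** Maps defined on the ambient types spare the construction of a bijection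
    between subtypes: [g] and [h] may do anything outside the vertices. *)
Lemma simplicial_iso_of_maps (g : V -> W) (h : W -> V) :
    (forall F, F \in faces K -> g @: F \in faces L) ->
    (forall G, G \in faces L -> h @: G \in faces K) ->
    {in vertices K, cancel g h} -> {in vertices L, cancel h g} ->
  simplicial_iso K L.
Proof.
move=> gF hF gK hK.
have gV v : v \in vertices K -> g v \in vertices L.
  by rewrite !inE => /gF; rewrite imset_set1.
have hV w : w \in vertices L -> h w \in vertices K.
  by rewrite !inE => /hF; rewrite imset_set1.
pose f (v : {v | v \in vertices K}) : {w | w \in vertices L} :=
  Sub (g (val v)) (gV _ (valP v)).
pose f' (w : {w | w \in vertices L}) : {v | v \in vertices K} :=
  Sub (h (val w)) (hV _ (valP w)).
exists f; split.
  exists f' => [v|w]; apply: val_inj => /=.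
    exact/gK/valP.
  exact/hK/valP.
move=> F.
have -> : val @: (f @: F) = g @: (val @: F).
  by rewrite -!imset_comp; apply: eq_imset => v.
apply/idP/idP => [/gF //|/hF].
suff -> : h @: (g @: (val @: F)) = val @: F by [].
by rewrite -!imset_comp; apply: eq_imset => v /=; exact/gK/valP.
Qed.

End Complexes.

(** * Covers, arcs and their endpoints *)

Lemma connect_within_sym (T : finType) (e : rel T) (A : {set T}) :
  symmetric e -> connect_sym (within e A).
Proof.
by move=> es; apply: sym_connect_sym => u v /=; rewrite es andbCA.
Qed.

Section Poset.
Variables (d : Order.disp_t) (P : finPOrderType d).
Implicit Types (p q r u v x y : P) (Q : {set P}) (N : {set {set P}}).
Implicit Types (a b : hasse_arc P) (A B : {set hasse_arc P}).

Lemma covers_lt p q : covers p q -> (p < q)%O.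
Proof. by case/andP. Qed.

(** The order of a finite poset is the reflexive transitive closure of its cover
    relation: an interval that is not a cover splits at an interior point into
    two intervals with fewer interior points. *)
Lemma le_ind_covers (r : P -> P -> Prop) :
    (forall x, r x x) -> (forall x y z, r x y -> r y z -> r x z) ->
    (forall x y, covers x y -> r x y) ->
  forall x y, (x <= y)%O -> r x y.
Proof.
move=> r0 rt rc x y.
have [n] := ubnP #|[set z | (x < z < y)%O]|.
elim: n x y => // n IHn x y; rewrite ltnS => le_n.
rewrite le_eqVlt => /predU1P[<- //|lt_xy].
have [c|] := boolP (covers x y); first exact: rc.
rewrite negb_and lt_xy /= negb_forall => /existsP[z]; rewrite negbK => /andP[xz zy].
have sub (s t : P) : (x <= s)%O -> (t <= y)%O -> ~~ (s < z < t)%O ->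
    (#|[set w | (s < w < t)%O]| < n)%N.
  move=> xs ty nz; apply: leq_trans le_n; apply: proper_card.
  apply/properP; split; last by exists z; rewrite !inE ?xz ?zy.
  apply/subsetP => w; rewrite !inE => /andP[sw wt].
  by rewrite (le_lt_trans xs sw) (lt_le_trans wt ty).
apply: (rt _ z); apply: IHn; rewrite ?ltW //; apply: sub; rewrite ?lexx ?ltxx ?andbF //.
  exact: ltW.
exact: ltW.
Qed.

Definition incident a x := (x == (val a).1) || (x == (val a).2).

Definition arcs_in Q : {set hasse_arc P} :=
  [set a | ((val a).1 \in Q) && ((val a).2 \in Q)].

Definition ends_of A : {set P} := [set x | [exists a in A, incident a x]].

Lemma ends_ofP A x :
  reflect (exists2 a, a \in A & incident a x) (x \in ends_of A).
Proof.
rewrite inE; apply: (iffP existsP) => [[a /andP[]]|[a aA ax]]; exists a => //.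
by rewrite aA.
Qed.

Lemma ends_of1 A a : a \in A -> (val a).1 \in ends_of A.
Proof. by move=> aA; apply/ends_ofP; exists a; rewrite // /incident eqxx. Qed.

Lemma ends_of2 A a : a \in A -> (val a).2 \in ends_of A.
Proof. by move=> aA; apply/ends_ofP; exists a; rewrite // /incident eqxx orbT. Qed.

Lemma incident_in Q a x : a \in arcs_in Q -> incident a x -> x \in Q.
Proof. by rewrite inE => /andP[a1 a2] /orP[]/eqP->. Qed.

Lemma ends_of_arcs_in_sub Q : ends_of (arcs_in Q) \subset Q.
Proof. by apply/subsetP => x /ends_ofP[a]; apply: incident_in. Qed.

Lemma arcs_in_ends_of A : A \subset arcs_in (ends_of A).
Proof. by apply/subsetP => a aA; rewrite in_set ends_of1 ?ends_of2. Qed.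

Lemma arcs_inS Q Q' : Q \subset Q' -> arcs_in Q \subset arcs_in Q'.
Proof.
move=> /subsetP s; apply/subsetP => a; rewrite !inE => /andP[/s-> /s->] //.
Qed.

Lemma ends_ofS A B : A \subset B -> ends_of A \subset ends_of B.
Proof.
move=> /subsetP s; apply/subsetP => x /ends_ofP[a /s aB ax].
by apply/ends_ofP; exists a.
Qed.

(** * Connectedness in the line graph and in the Hasse diagram *)

Lemma line_graphE a b :
  line_graph a b = (a != b) && [exists x, incident a x && incident b x].
Proof.
rewrite /line_graph /=; congr (_ && _); apply/idP/existsP => [|[x]].
  by rewrite /incident => /or4P[] /eqP e;
    [exists (val a).1|exists (val a).1|exists (val a).2|exists (val a).2];
    rewrite e !eqxx ?orbT.
by rewrite /incident => /andP[/orP[]/eqP-> /orP[]->]; rewrite ?orbT.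
Qed.

Lemma connect_line A a b x : a \in A -> b \in A -> incident a x -> incident b x ->
  connect (within (@line_graph d P) A) a b.
Proof.
move=> aA bA ax bx; have [->|ab] := eqVneq a b; first exact: connect0.
apply: connect1; rewrite /= aA bA /= -[X in is_true X]/(line_graph a b) line_graphE ab.
by apply/existsP; exists x; rewrite ax.
Qed.

Lemma hasse_arcP Q x y : x \in Q -> y \in Q -> hasse x y ->
  exists2 a, a \in arcs_in Q & incident a x /\ incident a y.
Proof.
move=> xQ yQ /orP[] c.
  by exists (exist _ (x, y) c); rewrite ?inE /incident /= ?xQ ?yQ ?eqxx ?orbT.
by exists (exist _ (y, x) c); rewrite ?inE /incident /= ?xQ ?yQ ?eqxx ?orbT.
Qed.

(** Every transfer of a property from single arcs to a connected set of arcs goes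
    through this lemma: [r] is taken to be connectedness in the Hasse diagram,
    equality of the values of a function, and simultaneous membership in a set. *)
Lemma connected_ends_rel A (r : rel P) : equivalence_rel r ->
    {in A, forall a, r (val a).1 (val a).2} -> induces_connected (@line_graph d P) A ->
  {in ends_of A &, forall x y, r x y}.
Proof.
move=> /equivalence_relP[r0 rt] rA /forall_inP cA x y.
have rs u v : r u v -> r v u by move=> /rt <-.
have inc a u v : a \in A -> incident a u -> incident a v -> r u v.
  move=> /rA ra /orP[]/eqP-> /orP[]/eqP-> //; exact: rs.
case/ends_ofP=> a aA ax /ends_ofP[b bA byy].
have /forall_inP/(_ b bA)/connectP[s] := cA a aA.
elim: s a aA x ax => [|c s IHs] a aA x ax /=.
  by move=> _ e; apply: (inc a) => //; rewrite -e.
case/andP=> /and3P[_ cA' ]; rewrite -[X in is_true X]/(line_graph a c) line_graphE.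
case/andP=> _ /existsP[z /andP[az cz]] ps e.
rewrite (rt x z); first exact: IHs cA' _ cz ps e.
exact: (inc a).
Qed.

(** Without the bound on the cardinal, a singleton would be a counterexample: it
    contains no arc. *)
Lemma ends_of_arcs_in Q : (1 < #|Q|)%N -> induces_connected (@hasse d P) Q ->
  ends_of (arcs_in Q) = Q.
Proof.
move=> Q1 cQ; apply/eqP; rewrite eqEsubset ends_of_arcs_in_sub /=.
apply/subsetP => x xQ.
have [y yQ yx] : exists2 y, y \in Q & y != x.
  apply/exists_inP; apply: contraTT Q1; rewrite negb_exists_in => /forall_inP h.
  rewrite -leqNgt (leq_trans _ (eq_leq (cards1 x))) //; apply: subset_leq_card.
  by apply/subsetP => y /h; rewrite negbK inE.
have /forall_inP/(_ x xQ)/forall_inP/(_ y yQ)/connectP[[|z s] /=] := cQ.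
  by move=> _ e; rewrite e eqxx in yx.
case/andP=> /and3P[_ zQ xz] _ _.
have [a aQ [ax _]] := hasse_arcP xQ zQ xz.
by apply/ends_ofP; exists a.
Qed.

(** A walk in the Hasse diagram between endpoints of two arcs is itself a sequence
    of arcs, consecutive ones sharing a vertex. *)
Lemma connected_arcs_in Q : induces_connected (@hasse d P) Q ->
  induces_connected (@line_graph d P) (arcs_in Q).
Proof.
move=> /forall_inP cQ; apply/forall_inP => a aQ; apply/forall_inP => b bQ.
have : incident a (val a).1 by rewrite /incident eqxx.
have : incident b (val b).1 by rewrite /incident eqxx.
move: (val a).1 (val b).1 => x y byy ax.
have xQ := incident_in aQ ax; have yQ := incident_in bQ byy.
have /forall_inP/(_ y yQ)/connectP[s] := cQ x xQ.
elim: s a x aQ ax xQ => [|z s IHs] a x aQ ax xQ /=.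
  by move=> _ e; apply: (connect_line aQ bQ ax); rewrite -e.
case/andP=> /and3P[_ zQ xz] ps e.
have [c cQ' [cx cz]] := hasse_arcP xQ zQ xz.
exact: connect_trans (connect_line aQ cQ' ax cx) (IHs _ _ cQ' cz zQ ps e).
Qed.

Lemma connected_ends_of A : induces_connected (@line_graph d P) A ->
  induces_connected (@hasse d P) (ends_of A).
Proof.
move=> cA.
pose e := within (@hasse d P) (ends_of A).
have es : connect_sym e.
  by apply: connect_within_sym => u v; rewrite /hasse /= orbC.
have er : equivalence_rel (connect e).
  apply/equivalence_relP; split=> [x|x y xy z]; first exact: connect0.
  exact: same_connect.
have eA : {in A, forall a, connect e (val a).1 (val a).2}.
  move=> a aA; apply: connect1; rewrite /e /= ends_of1 ?ends_of2 //=.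
  by apply/orP; left; apply: (valP a).
apply/forall_inP => x xA; apply/forall_inP => y yA.
exact: (connected_ends_rel er eA cA).
Qed.

(** This is how nestedness forbids two disjoint blocks with a common endpoint. *)
Lemma connected_setU A B x : induces_connected (@line_graph d P) A ->
    induces_connected (@line_graph d P) B -> x \in ends_of A -> x \in ends_of B ->
  induces_connected (@line_graph d P) (A :|: B).
Proof.
move=> cA cB /ends_ofP[a0 a0A a0x] /ends_ofP[b0 b0B b0x].
pose e := within (@line_graph d P) (A :|: B).
have es : connect_sym e.
  apply: connect_within_sym => u v; rewrite !line_graphE eq_sym.
  by congr (_ && _); apply: eq_existsb => z; rewrite andbC.
have sub (C : {set hasse_arc P}) a b : C \subset A :|: B ->
    induces_connected (@line_graph d P) C ->
    a \in C -> b \in C -> connect e a b.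
  move=> /subsetP sC /forall_inP/(_ a) cC /cC/forall_inP h /h.
  apply: connect_sub => u v /and3P[/sC uC /sC vC uv].
  by apply: connect1; rewrite /e /= uC vC.
have to0 a : a \in A :|: B -> connect e a a0.
  rewrite inE => /orP[aA|aB]; first by apply: (sub A); rewrite ?subsetUl.
  apply: (connect_trans (sub B _ b0 _ _ _ _)); rewrite ?subsetUr //.
  by apply: (connect_line _ _ b0x a0x); rewrite inE ?a0A ?b0B ?orbT.
apply/forall_inP => a aU; apply/forall_inP => b bU.
by apply: connect_trans (to0 a aU) _; rewrite -/e es; apply: to0.
Qed.

Lemma arcs_in_block Q : pipe Q -> arcs_in Q \in poset_building_set P.
Proof.
case/and3P=> Q1 cQ _; rewrite inE connected_arcs_in // andbT.
apply/eqP => E0; move: (ends_of_arcs_in Q1 cQ); rewrite E0 => Q0.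
suff : Q = set0 by move=> e; rewrite e cards0 in Q1.
apply/setP => x; rewrite -Q0 [in RHS]inE; apply/negbTE/ends_ofP => -[a].
by rewrite inE.
Qed.

Lemma pipe_ends_of_arcs_in Q : pipe Q -> ends_of (arcs_in Q) = Q.
Proof. by case/and3P=> Q1 cQ _; apply: ends_of_arcs_in. Qed.

(** * Faces of the graphical oriented matroid *)

Section Faces.
Variable R : realType.
Implicit Types (f : P -> R).

(** A potential for [A] certifies that [A] is a face: it is a linear form
    recorded by its values on the standard basis. *)
Definition potential f A := forall a,
  if a \in A then f (val a).1 = f (val a).2 else f (val a).2 < f (val a).1.

Definition weighted_sum f (x : {ffun P -> R^o}) : R := \sum_p x p * f p.

Lemma weighted_sum_is_linear f : linear_for *%R (weighted_sum f).
Proof.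
move=> c x y; rewrite /weighted_sum mulr_sumr -big_split; apply: eq_bigr => p _ /=.
by rewrite !ffunE mulrDl mulrA.
Qed.

HB.instance Definition _ f := GRing.isLinear.Build R {ffun P -> R^o} R *%R
  (weighted_sum f) (weighted_sum_is_linear f).

Lemma weighted_sum_std f p : weighted_sum f (std_basis R p) = f p.
Proof.
rewrite /weighted_sum (bigD1 p) //= ffunE eqxx mul1r big1 ?addr0 // => q qp.
by rewrite ffunE (negbTE qp) mul0r.
Qed.

Lemma is_faceP A : reflect (exists f, potential f A) (is_face (poset_matroid P R) A).
Proof.
rewrite /is_face /poset_matroid /vector_matroid inE.
apply: (iffP (asboolP _)) => [[phi [eA e0]]|[f fA]].
  exists (fun p => phi (std_basis R p)) => a.
  have /setP/(_ a) := eA; rewrite !inE /arc_vector linearB subr_gt0 => aA.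
  have /setP/(_ a) := e0; rewrite !inE /arc_vector linearB subr_lt0.
  move/esym/negbT; rewrite -leNgt => le12.
  case: ifP aA => // aA /esym/negbT; rewrite -leNgt => le21.
  by apply/eqP; rewrite eq_le le12 le21.
have fE a : weighted_sum f (arc_vector R a) = f (val a).1 - f (val a).2.
  by rewrite /arc_vector linearB /= !weighted_sum_std.
exists (weighted_sum f); congr pair; apply/setP => a; move: (fA a);
  rewrite !inE /= fE ?subr_gt0 ?subr_lt0; case: (a \in A) => //= h.
- by rewrite h ltxx.
- by rewrite h ltxx.
- by apply/esym/negbTE; rewrite -leNgt ltW.
Qed.

Lemma potential_cover f A x y : potential f A -> covers x y -> f y <= f x.
Proof.
move=> fA c; move: (fA (exist _ (x, y) c)); case: ifP => _ /=.
  by move->.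
exact: ltW.
Qed.

Lemma potential_antitone f A x y : potential f A -> (x <= y)%O -> f y <= f x.
Proof.
move=> fA; apply: (le_ind_covers (r := fun x y => f y <= f x)) => //.
  by move=> u v w vu wv; apply: le_trans wv vu.
by move=> u v; apply: potential_cover fA.
Qed.

(** Going up at a constant value of [f] uses only arcs of [A], so a set stable
    under those arcs is never left. *)
Lemma potential_level_closed f A (X : {set P}) x y : potential f A ->
    (forall a, a \in A -> (val a).1 \in X -> (val a).2 \in X) ->
  (x <= y)%O -> f x = f y -> x \in X -> y \in X.
Proof.
move=> fA XA xy.
pose r u v := f v <= f u /\ (f u = f v -> u \in X -> v \in X).
suff [] : r x y by [].
move: x y xy; apply: le_ind_covers => [u|u v w [vu uvX] [wv vwX]|u v c].
- by split.
- split=> [|uw uX]; first exact: le_trans wv vu.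
  have e : f u = f v by apply/eqP; rewrite eq_le vu andbT uw.
  by apply: vwX; [rewrite -e | apply: uvX].
- split=> [|e]; first exact: potential_cover fA c.
  have := fA (exist _ (u, v) c); case: ifP => [/XA //|_ /=].
  by rewrite e ltxx.
Qed.

Lemma potential_connected f A : potential f A ->
    forall B, B \subset A -> induces_connected (@line_graph d P) B ->
  {in ends_of B &, forall x y, f x = f y}.
Proof.
move=> fA B /subsetP BA cB x y xB yB; apply/eqP.
apply: (connected_ends_rel (r := [rel x y | f x == f y])) cB _ _ xB yB.
  by apply/equivalence_relP; split=> [u|u v /= /eqP uv w] /=; rewrite ?uv.
by move=> a /BA aA /=; move: (fA a); rewrite aA => ->.
Qed.

(** Convexity of the set of endpoints: [f] is constant on it by connectedness, so
    any element between two of its points is reached at a constant value.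
    The set of arcs is full because [f] would decrease strictly along an arc
    outside [A] between two endpoints. *)
Lemma face_block A : A \in poset_building_set P -> is_face (poset_matroid P R) A ->
  pipe (ends_of A) /\ arcs_in (ends_of A) = A.
Proof.
rewrite inE => /andP[/set0Pn[a aA] cA] /is_faceP[f fA].
have fc := potential_connected fA (subxx A) cA.
split.
  apply/and3P; split; last 1 first.
  - apply/forall_inP => x xA; apply/forallP => y; apply/forall_inP => z zA.
    apply/implyP => /andP[xy yz].
    apply: (potential_level_closed fA _ xy _ xA) => [b bA _|]; first exact: ends_of2.
    apply/eqP; rewrite eq_le (potential_antitone fA xy) andbT.
    by rewrite (fc x z) // (potential_antitone fA yz).
  - rewrite (cardsD1 (val a).1) ends_of1 // (cardsD1 (val a).2) in_setD1 ends_of2 //.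
    by rewrite eq_sym (lt_eqF (covers_lt (valP a))).
  - exact: connected_ends_of.
apply/eqP; rewrite eqEsubset arcs_in_ends_of andbT; apply/subsetP => b.
rewrite inE => /andP[b1 b2]; apply: contraTT isT => bA.
by move: (fA b); rewrite (negbTE bA) (fc _ _ b1 b2) ltxx.
Qed.

(** * Acyclicity *)

(** Acyclicity is defined through cycles without repetition, so the walk from [X]
    to [Y] is first shortened to a simple path. *)
Lemma acyclic_connect (T : finType) (e : rel {set T}) (N : {set {set T}}) X Y :
    induces_acyclic e N -> X \in N ->
  connect (within e N) X Y -> ~~ e Y X.
Proof.
move=> ac XN /connectP[s0 /shortenP[s ps us _] {s0}->]; apply/negP => YX.
have sN : {subset X :: s <= N}.
  move=> Z; rewrite inE => /predU1P[-> //|].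
  elim: s X {XN us YX} ps => //= W s IHs X /andP[/and3P[_ WN _] ps].
  by rewrite inE => /predU1P[-> //|]; apply: IHs ps.
apply: (ac (X :: s)) => //; rewrite /ucycle us andbT /= rcons_path YX andbT.
by apply: sub_path ps => U V /and3P[].
Qed.

(** The function counts the elements reachable from a point by going up in the
    order and jumping inside pipes of [N]. It is constant on pipes. It decreases
    strictly along an arc from [u] to [v] unless [u] is reachable from [v];
    then there is a walk of pipes from some [Q] above [v] to some [Q'] below [u],
    and since [Q'] lies below [Q] this closes a cycle, unless [Q' = Q], when
    convexity puts the arc inside [Q]. *)
Lemma disjoint_pipes_face N : {in N, forall Q, pipe Q} ->
    {in N &, forall Q Q', Q != Q' -> [disjoint Q & Q']} ->
    induces_acyclic (@pipe_arc d P) N ->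
  is_face (poset_matroid P R) (\bigcup_(Q in N) arcs_in Q).
Proof.
move=> Np Nd Na; apply/is_faceP.
pose e := within (@pipe_arc d P) N.
pose via x y := [exists Q in N, exists Q' in N, [&& connect e Q Q',
  [exists q in Q, (x <= q)%O] & [exists q in Q', (q <= y)%O]]].
have viaP x y : reflect (exists Q Q' q q', [/\ Q \in N, Q' \in N, connect e Q Q' &
    [/\ q \in Q, (x <= q)%O, q' \in Q' & (q' <= y)%O]]) (via x y).
  apply: (iffP exists_inP) => [[Q QN /exists_inP[Q' Q'N]]|].
    by case/and3P=> c /exists_inP[q qQ xq] /exists_inP[q' q'Q' q'y]; exists Q, Q', q, q'.
  case=> Q [Q' [q [q' [QN Q'N c [qQ xq q'Q' q'y]]]]].
  exists Q => //; apply/exists_inP; exists Q' => //; rewrite c /=.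
  by apply/andP; split; apply/exists_inP; [exists q | exists q'].
have arcN Q Q' q q' : Q \in N -> Q' \in N -> Q != Q' -> q \in Q -> q' \in Q' ->
    (q <= q')%O -> pipe_arc Q Q'.
  move=> QN Q'N QQ' qQ q'Q' le; have dQ := Nd _ _ QN Q'N QQ'.
  rewrite /pipe_arc /= dQ; apply/exists_inP; exists q => //.
  apply/exists_inP; exists q' => //; rewrite lt_neqAle le andbT.
  by apply: contraTneq qQ => ->; rewrite (disjointFl dQ).
(* Passing through pipes needs only one block of consecutive pipes: if one walk
   ends in [Q'] and the next starts in [Q2], then [Q'] has a point below one of
   [Q2], so the two pipes are equal or joined by an arc of the pipe digraph. *)
pose reach x y := (x <= y)%O || via x y.
have reach_trans x y z : reach x y -> reach y z -> reach x z.
  case/orP=> [xy|/viaP[Q [Q' [q [q' [QN Q'N c [qQ xq q'Q' q'y]]]]]]].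
    case/orP=> [yz|/viaP[Q [Q' [q [q' [QN Q'N c [qQ yq q'Q' q'z]]]]]]].
      by rewrite /reach (le_trans xy yz).
    apply/orP; right; apply/viaP; exists Q, Q', q, q'; split=> //; split=> //.
    exact: le_trans xy yq.
  case/orP=> [yz|/viaP[Q2 [Q3 [q2 [q3 [Q2N Q3N c2 [qQ2 yq2 q3Q3 q3z]]]]]]];
    apply/orP; right; apply/viaP.
    exists Q, Q', q, q'; split=> //; split=> //.
    exact: le_trans q'y yz.
  exists Q, Q3, q, q3; split=> //.
  apply: connect_trans c (connect_trans _ c2).
  have [->|ne] := eqVneq Q' Q2; first exact: connect0.
  apply: connect1; rewrite /e /= Q'N Q2N /=.
  by apply: (arcN _ _ q' q2) => //; apply: le_trans q'y yq2.
exists (fun x => #|[set z | reach x z]|%:R) => a.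
have le_f x y : reach x y -> [set z | reach y z] \subset [set z | reach x z].
  by move=> xy; apply/subsetP => z; rewrite !inE; apply: reach_trans.
have r12 : reach (val a).1 (val a).2.
  by rewrite /reach (ltW (covers_lt (valP a))).
have rr x : reach x x by rewrite /reach lexx.
case: ifP => [/bigcupP[Q QN]|naN].
  rewrite inE => /andP[a1 a2].
  suff -> : [set z | reach (val a).1 z] = [set z | reach (val a).2 z] by [].
  apply/eqP; rewrite eqEsubset !le_f //; apply/orP; right; apply/viaP.
  by exists Q, Q, (val a).2, (val a).1; split.
rewrite ltr_nat; apply: proper_card; rewrite properEneq le_f // andbT.
have lt12 := covers_lt (valP a).
apply/negP => /eqP/setP/(_ (val a).1); rewrite !inE rr.
case/orP=> [le|/viaP[Q [Q' [q [q' [QN Q'N c [qQ xq q'Q' q'y]]]]]]].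
  by rewrite (lt_geF lt12) in le.
(* Now [q' <= (val a).1 < (val a).2 <= q] with [q'] in [Q'] and [q] in [Q]. *)
have [eQ|ne] := eqVneq Q' Q; last first.
  have /negP := acyclic_connect Na QN c; apply.
  apply: (arcN _ _ q' q) => //.
  exact: le_trans q'y (le_trans (ltW lt12) xq).
have /and3P[_ _ /forall_inP cQ] := Np _ QN.
rewrite eQ in q'Q'.
have conv u : (q' <= u <= q)%O -> u \in Q.
  by move/implyP: (forall_inP (forallP (cQ q' q'Q') u) q qQ).
move/negbT/bigcupP: naN; apply; exists Q => //.
by rewrite inE !conv ?q'y ?xq ?(le_trans q'y (ltW lt12)) ?(le_trans (ltW lt12) xq).
Qed.

(** It is enough to look at one arc of a supposed cycle, leaving a pipe that is
    chosen extremal in two steps: [f] is minimal on it, and its cardinal is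
    maximal among the pipes of the cycle through one fixed minimizer [x0] of [f].
    Fixing the point [x0] makes any larger competitor a pipe through [x0]. *)
Lemma faces_acyclic N : {in N, forall Q, pipe Q} ->
    {in N &, forall Q Q', nested_or_disjoint Q Q'} ->
    (forall N', N' \subset N ->
      is_face (poset_matroid P R) (\bigcup_(Q in N') arcs_in Q)) ->
  induces_acyclic (@pipe_arc d P) N.
Proof.
move=> Np Nn Nf [//|Q0 s] _ cN /andP[cyc _].
set c := Q0 :: s in cN cyc.
pose C := [set Q in c].
have /Nf/is_faceP[f fA] : C \subset N by apply/subsetP => Q; rewrite inE => /cN.
have fQ Q : Q \in c -> {in Q &, forall x y, f x = f y}.
  move=> Qc; have pQ := Np _ (cN _ Qc).
  rewrite -[in {in Q &, _}](pipe_ends_of_arcs_in pQ).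
  apply: (potential_connected fA); first by apply: bigcup_sup; rewrite inE.
  by apply: connected_arcs_in; case/and3P: pQ.
have Q0c : Q0 \in c by rewrite mem_head.
have [y0 y0Q0] : exists y, y \in Q0.
  have /and3P[Q1 _ _] := Np _ (cN _ Q0c).
  by apply/set0Pn; rewrite -card_gt0 ltnW.
have y0C : y0 \in cover C by apply/bigcupP; exists Q0; rewrite ?inE ?eqxx.
case: (arg_minP f y0C) => x0 /bigcupP[Q1]; rewrite inE => Q1c x0Q1 xmin.
have h1 : [pred Q : {set P} | (Q \in c) && (x0 \in Q)] Q1 by rewrite /= Q1c.
case: (arg_maxnP (fun Q : {set P} => #|Q|) h1) => /= Q /andP[Qc x0Q] Qmax.
have := next_cycle cyc Qc; set Q' := next c Q.
have Q'c : Q' \in c by rewrite mem_next.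
case/andP=> dQ /exists_inP[q qQ /exists_inP[r rQ' qr]].
have := disjointFl dQ rQ'; suff -> : r \in Q by [].
apply: (potential_level_closed fA _ (ltW qr) _ qQ); last first.
  apply/eqP; rewrite eq_le (potential_antitone fA (ltW qr)) andbT.
  rewrite (fQ Q Qc q x0) //; apply: xmin.
  by apply/bigcupP; exists Q'; rewrite ?inE.
(* Arcs of the face cannot leave [Q]: their pipe [Q2] meets [Q]. *)
move=> a /bigcupP[Q2]; rewrite [_ \in C]inE => Q2c; rewrite inE => /andP[a1 a2] a1Q.
have /or3P[sQ|/subsetP sQ|dis] := Nn _ _ (cN _ Qc) (cN _ Q2c).
- have x02 := subsetP sQ _ x0Q.
  have eQ : Q = Q2.
    apply/eqP; rewrite eqEcard sQ; apply: Qmax; by rewrite Q2c.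
  by rewrite eQ.
- exact: sQ.
- by rewrite (disjointFr dis a1Q) in a1.
Qed.

(** * The isomorphism *)

Hypotheses (cardP : (1 < #|P|)%N)
  (connP : induces_connected (@hasse d P) [set: P]).

Lemma pipe_setT : pipe [set: P].
Proof.
rewrite /pipe cardsT cardP connP /=; apply/forall_inP => p _; apply/forallP => q.
by apply/forall_inP => r _; rewrite inE implybT.
Qed.

Lemma arcs_in_setT : arcs_in [set: P] = [set: hasse_arc P].
Proof. by apply/setP => a; rewrite !inE. Qed.

Lemma maximal_blocks_poset :
  maximal_blocks (poset_building_set P) = [set arcs_in [set: P]].
Proof.
have TB := arcs_in_block pipe_setT.
apply/setP => A; rewrite !inE; apply/maxsetP/eqP => [[_ mA]|->].
  by apply/esym/mA; rewrite ?TB // arcs_in_setT subsetT.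
by split=> // B _; rewrite arcs_in_setT subTset => /eqP.
Qed.

(** Disconnectedness of a union of several disjoint blocks is detected on one of
    them, [arcs_in Q]: no arc of the union has exactly one end in [Q]. *)
Lemma arcs_in_acyclic_nested N : is_piping N ->
  acyclic_nested_set (poset_building_set P) (poset_matroid P R) [set arcs_in Q | Q in N].
Proof.
case=> Np Nn NT Na.
have ne Q : Q \in N -> exists a, a \in arcs_in Q.
  by move/Np/arcs_in_block; rewrite inE => /andP[/set0Pn].
split; first split.
- by apply/subsetP => _ /imsetP[Q QN ->]; apply/arcs_in_block/Np.
- by rewrite maximal_blocks_poset sub1set imset_f.
- move=> _ _ /imsetP[Q QN ->] /imsetP[Q' Q'N ->].
  case/or3P: (Nn _ _ QN Q'N) => [s|s|dQ]; apply/or3P.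
  + by constructor 1; apply: arcs_inS.
  + by constructor 2; apply: arcs_inS.
  + constructor 3; rewrite disjoint_subset; apply/subsetP => a.
    by rewrite !inE => /andP[a1 _]; rewrite (disjointFr dQ a1).
- move=> N' /subsetP sN /card_gt1P[A [B [QN' Q'N' neq]]] triv.
  have /imsetP[Q QN eA] := sN _ QN'; rewrite {A}eA in QN' neq.
  have /imsetP[Q' Q'N eB] := sN _ Q'N'; rewrite {B}eB in Q'N' neq.
  rewrite inE negb_and; apply/orP; right; apply/negP => conn.
  have sub (S : {set P}) : arcs_in S \in N' -> S \in N -> S \subset ends_of (cover N').
    move=> SN' SN; rewrite -{1}(pipe_ends_of_arcs_in (Np _ SN)).
    by apply: ends_ofS; apply: bigcup_sup SN'.
  have dis (S : {set P}) : arcs_in S \in N' -> S \in N ->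
      arcs_in Q != arcs_in S -> [disjoint Q & S].
    move=> SN' SN neS; have dA := trivIsetP triv _ _ QN' SN' neS.
    case/or3P: (Nn _ _ QN SN) => [/arcs_inS/subsetP s|/arcs_inS/subsetP s|//].
    + by have [a aQ] := ne _ QN; have := s a aQ; rewrite (disjointFr dA aQ).
    + by have [a aS] := ne _ SN; have := s a aS; rewrite (disjointFl dA aS).
  have er : equivalence_rel [rel x y | (x \in Q) == (y \in Q)].
    by apply/equivalence_relP; split=> [u|u v /= /eqP uv w] /=; rewrite ?uv.
  have eA : {in cover N', forall a, (val a).1 \in Q == ((val a).2 \in Q)}.
    move=> a /bigcupP[B BN']; have /imsetP[S SN eB] := sN _ BN'.
    rewrite {B}eB in BN' *; rewrite inE => /andP[a1 a2].
    have [eS|neS] := eqVneq (arcs_in Q) (arcs_in S).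
      have -> : Q = S.
        by rewrite -(pipe_ends_of_arcs_in (Np _ QN)) eS pipe_ends_of_arcs_in ?Np.
      by rewrite a1 a2.
    have dS := dis _ BN' SN neS.
    by rewrite (disjointFl dS a1) (disjointFl dS a2).
  have [a aQ] := ne _ QN; have [b bQ'] := ne _ Q'N.
  move: aQ bQ'; rewrite !inE => /andP[a1 _] /andP[b1 _].
  have := connected_ends_rel er eA conn (subsetP (sub _ QN' QN) _ a1)
    (subsetP (sub _ Q'N' Q'N) _ b1).
  by rewrite /= a1 (disjointFl (dis _ Q'N' Q'N neq) b1).
- move=> N' /subsetP sN.
  (* Passing to maximal members keeps the union and makes the pipes disjoint. *)
  pose X := [set Q in N | arcs_in Q \in N'].
  pose M := [set Q | maxset (fun Q => Q \in X) Q].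
  have MX Q : Q \in M -> Q \in X by rewrite inE => /maxsetp.
  have XN Q : Q \in X -> Q \in N by rewrite inE => /andP[].
  have -> : cover N' = \bigcup_(Q in M) arcs_in Q.
    apply/setP => a; apply/bigcupP/bigcupP => [[A AN' aA]|[Q QM aQ]].
      have /imsetP[Q QN eA] := sN _ AN'; rewrite {A}eA in AN' aA.
      have QX : Q \in X by rewrite inE QN.
      have [Q' Q'M QQ'] := maxset_exists (P := fun Q => Q \in X) QX.
      by exists Q'; [rewrite inE | apply: (subsetP (arcs_inS QQ'))].
    by exists (arcs_in Q) => //; have := MX _ QM; rewrite inE => /andP[].
  apply: disjoint_pipes_face => [Q /MX/XN /Np //|Q Q' QM Q'M|].
    have /or3P[s|s|//] := Nn _ _ (XN _ (MX _ QM)) (XN _ (MX _ Q'M)).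
      move: QM; rewrite inE => /maxsetP[_ /(_ Q' (MX _ Q'M) s)->].
      by rewrite eqxx.
    move: Q'M; rewrite inE => /maxsetP[_ /(_ Q (MX _ QM) s)->].
    by rewrite eqxx.
  by move=> c c0 cM; apply: Na => // Q /cM/MX/XN.
Qed.

(** One-element subfamilies already force every block to be a face. *)
Lemma acyclic_nested_blocks (N : {set {set hasse_arc P}}) :
    acyclic_nested_set (poset_building_set P) (poset_matroid P R) N ->
  {in N, forall A, pipe (ends_of A) /\ arcs_in (ends_of A) = A}.
Proof.
move=> [[NB _ _ _] Na] A AN; apply: face_block; first exact: (subsetP NB).
by have := Na [set A]; rewrite sub1set /cover big_set1 => /(_ AN).
Qed.

Lemma ends_of_piping (N : {set {set hasse_arc P}}) :
    acyclic_nested_set (poset_building_set P) (poset_matroid P R) N ->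
  is_piping [set ends_of A | A in N].
Proof.
move=> aN; have Npipe := acyclic_nested_blocks aN.
case: aN => [[/subsetP NB Nk Nn Nu] Na].
have pN : {in [set ends_of A | A in N], forall Q, pipe Q}.
  by move=> _ /imsetP[A AN ->]; case: (Npipe A AN).
have nN : {in [set ends_of A | A in N] &, forall Q Q', nested_or_disjoint Q Q'}.
  move=> _ _ /imsetP[A AN ->] /imsetP[B BN ->]; apply/or3P.
  case/or3P: (Nn _ _ AN BN) => [s|s|dAB].
  - by constructor 1; apply: ends_ofS.
  - by constructor 2; apply: ends_ofS.
  constructor 3; rewrite disjoint_subset; apply/subsetP => x xA; apply/negP => xB.
  move: (NB _ AN) (NB _ BN); rewrite !inE => /andP[/set0Pn[a aA] cA] /andP[_ cB].
  have neq : A != B by apply/eqP => eA; have := disjointFr dAB aA; rewrite -eA aA.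
  apply: (negP (Nu [set A; B] _ _ _)).
  - by apply/subsetP => C; rewrite !inE => /orP[]/eqP->.
  - by rewrite cards2 neq.
  - apply/trivIsetP => C D; rewrite !inE => /orP[]/eqP-> /orP[]/eqP->; rewrite ?eqxx //.
    by rewrite disjoint_sym.
  - rewrite /cover bigcup_setU !big_set1 inE (connected_setU cA cB xA xB) andbT.
    by apply/set0Pn; exists a; rewrite inE aA.
split=> //.
- apply/imsetP; exists (arcs_in [set: P]); last first.
    by rewrite pipe_ends_of_arcs_in // pipe_setT.
  by move: Nk; rewrite maximal_blocks_poset sub1set.
- apply: faces_acyclic => // N' /subsetP sN.
  have -> : \bigcup_(Q in N') arcs_in Q = cover [set arcs_in Q | Q in N'].
    by rewrite cover_imset.
  apply: Na; apply/subsetP => _ /imsetP[Q /sN/imsetP[A AN ->] ->].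
  by case: (Npipe A AN) => _ ->.
Qed.

Lemma arcs_in_face F : F \in faces (piping_complex P) ->
  arcs_in @: F \in
    faces (acyclic_nested_complex (poset_building_set P) (poset_matroid P R)).
Proof.
case/imsetP=> N; rewrite inE => /asboolP pN ->.
apply/imsetP; exists [set arcs_in Q | Q in N].
  by rewrite inE; apply/asboolP/arcs_in_acyclic_nested.
rewrite maximal_blocks_poset; case: pN => Np _ NT _.
apply/setP => A; rewrite !inE; apply/imsetP/andP => [[Q]|[AT /imsetP[Q QN eA]]].
  rewrite !inE => /andP[QT QN] ->; split; last exact: imset_f.
  apply: contra_neq QT => e.
  by rewrite -(pipe_ends_of_arcs_in (Np _ QN)) e pipe_ends_of_arcs_in ?Np.
by exists Q; rewrite // !inE QN andbT; apply: contra_neq AT => <-.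
Qed.

Lemma ends_of_face F :
    F \in faces (acyclic_nested_complex (poset_building_set P) (poset_matroid P R)) ->
  ends_of @: F \in faces (piping_complex P).
Proof.
case/imsetP=> N; rewrite inE => /asboolP aN ->.
have Nb := acyclic_nested_blocks aN.
apply/imsetP; exists [set ends_of A | A in N].
  by rewrite inE; apply/asboolP/ends_of_piping.
rewrite maximal_blocks_poset.
apply/setP => Q; rewrite !inE; apply/imsetP/andP => [[A]|[QT /imsetP[A AN eQ]]].
  rewrite !inE => /andP[AT AN] ->; split; last exact: imset_f.
  by apply: contra_neq AT => e; case: (Nb A AN) => _ <-; rewrite e.
exists A; rewrite // !inE AN andbT; apply: contra_neq QT => eA.
by rewrite eQ eA pipe_ends_of_arcs_in // pipe_setT.
Qed.

Lemma arcs_inK : {in vertices (piping_complex P), cancel arcs_in ends_of}.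
Proof.
move=> Q; rewrite inE => /imsetP[N]; rewrite inE => /asboolP[Np _ _ _] /setP/(_ Q).
by rewrite !inE eqxx => /esym/andP[_ /Np/pipe_ends_of_arcs_in].
Qed.

Lemma ends_ofK :
  {in vertices (acyclic_nested_complex (poset_building_set P) (poset_matroid P R)),
    cancel ends_of arcs_in}.
Proof.
move=> A; rewrite inE => /imsetP[N]; rewrite inE => /asboolP aN /setP/(_ A).
by rewrite !inE eqxx => /esym/andP[_ /(acyclic_nested_blocks aN)[]].
Qed.

End Faces.
End Poset.

Theorem proposition10p3 (R : realType) (d : Order.disp_t)
    (P : finPOrderType d) (cardP : (1 < #|P|)%N)
    (connP : induces_connected (@hasse d P) [set: P]) :
  simplicial_iso (piping_complex P)
    (acyclic_nested_complex (poset_building_set P) (poset_matroid P R)).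
Proof.
apply: (simplicial_iso_of_maps (g := @arcs_in d P) (h := @ends_of d P)).
- exact: arcs_in_face.
- exact: ends_of_face.
- exact: arcs_inK.
- exact: ends_ofK.
Qed.
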